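(* Let $n$ be sufficiently large. In the $(1:1)$ WMaker--WBreaker Connectivity game on $E(K_n)$ (with WBreaker making the first move), WMaker has a strategy to win in at most $n+1$ moves, i.e. to ensure that after at most $n+1$ of her own moves the graph formed by her claimed edges contains a spanning tree of $K_n$.
   Context: The $(1:1)$ WMaker--WBreaker game on $E(K_n)$: two players, WMaker and WBreaker, alternately claim one edge of the complete graph $K_n$ per turn. Both players are walkers: at her/his first move a player chooses any vertex as starting position; when a player is positioned at a vertex $v$, she/he may only claim an edge incident with $v$ that has not previously been claimed by the opponent, and the other endpoint of the claimed edge becomes her/his new position. Unless stated otherwise WBreaker starts, so a round consists of a move of WBreaker followed by a move of WMaker. In the Connectivity game WMaker wins once her claimed edges contain the edge set of a spanning tree of $K_n$. *)

(* Defs.v *)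
From mathcomp Require Import all_boot.

Set Implicit Arguments.
Unset Strict Implicit.
Unset Printing Implicit Defensive.

(* MathComp world. Graphs on the vertex set 'I_n are sets of two-element sets. *)

Definition complete_edges (n : nat) : {set {set 'I_n}} :=
  [set e : {set 'I_n} | #|e| == 2].

Definition adj (n : nat) (E : {set {set 'I_n}}) : rel 'I_n :=
  fun u v => [set u; v] \in E.

Definition connected_graph (n : nat) (E : {set {set 'I_n}}) : Prop :=
  forall u v : 'I_n, connect (adj E) u v.

(* [ucycle] also accepts the closed walk u, v, u, hence the bound on [size c]. *)
Definition acyclic_graph (n : nat) (E : {set {set 'I_n}}) : Prop :=
  ~ exists c : seq 'I_n, 2 < size c /\ ucycle (adj E) c.

Definition spanning_tree (n : nat) (T : {set {set 'I_n}}) : Prop :=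
  [/\ T \subset complete_edges n, connected_graph T & acyclic_graph T].

Definition contains_spanning_tree (n : nat) (E : {set {set 'I_n}}) : Prop :=
  exists T : {set {set 'I_n}}, T \subset E /\ spanning_tree T.

(* A move (u, v) claims the edge uv by walking from u to v. The moves of a player
   are listed in chronological order. *)
Definition move (n : nat) : Type := ('I_n * 'I_n)%type.

Definition move_edge (n : nat) (m : move n) : {set 'I_n} := [set m.1; m.2].

Definition claimed (n : nat) (s : seq (move n)) : {set {set 'I_n}} :=
  [set e in [seq move_edge m | m <- s]].

(* The starting vertex is chosen freely as part of the first move. *)
Definition from_position (n : nat) (own : seq (move n)) (m : move n) : bool :=
  if own is m0 :: s then m.1 == (last m0 s).2 else true.

(* A player may walk again along an edge of her/his own; this counts as a move.
   Hence from the second move on she/he can at least walk back, and never gets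
   stuck. *)
Definition legal_move (n : nat) (own opp : seq (move n)) (m : move n) : bool :=
  [&& from_position own m, move_edge m \in complete_edges n
    & move_edge m \notin claimed opp].

(* The next move of WMaker, given the moves so far of WBreaker and of WMaker. *)
Definition strategy (n : nat) : Type := seq (move n) -> seq (move n) -> move n.

(* The plays [bs] (WBreaker), [ms] (WMaker) in which WBreaker moves first and
   plays arbitrary legal moves, while WMaker follows [sigma]. *)
Inductive play (n : nat) (sigma : strategy n) :
    seq (move n) -> seq (move n) -> Prop :=
| play_start : play sigma [::] [::]
| play_WBreaker (bs ms : seq (move n)) (b : move n) :
    play sigma bs ms -> size bs = size ms -> legal_move bs ms b ->
    play sigma (rcons bs b) ms
| play_WMaker (bs ms : seq (move n)) :
    play sigma bs ms -> size bs = (size ms).+1 ->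
    play sigma bs (rcons ms (sigma bs ms)).

Definition legal_strategy (n : nat) (sigma : strategy n) : Prop :=
  forall bs ms : seq (move n), play sigma bs ms -> size bs = (size ms).+1 ->
    legal_move ms bs (sigma bs ms).

(* No play stops early (see [legal_move]), so it suffices to inspect the plays in
   which WMaker has made exactly N moves. *)
Definition wins_connectivity_within (n : nat) (sigma : strategy n) (N : nat) :
    Prop :=
  forall bs ms : seq (move n), play sigma bs ms -> size ms = N ->
    exists2 k, k <= N & contains_spanning_tree (claimed (take k ms)).

(* Main.v *)
(* Let U be the set of vertices WMaker has not visited, B the graph of WBreaker, and p, v
   the positions of WBreaker and WMaker. WMaker keeps U independent in B, with no B-edge
   from v to U except possibly one when p = v: if WBreaker walks from p to q inside U, she
   moves to q, so that pq becomes that exception; otherwise she moves to any vertex of U that is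
   not B-adjacent to v. This never wastes a move until at most two vertices are left, and
   those cost at most two wasted moves: a wasted move leads to a vertex y without B-edges
   to the relevant vertices, and WBreaker can block an edge ya only when standing at y or a.
   Such a y exists because WBreaker walks: a walk of T steps gives a set A at most
   (2T+2)/3 neighbours outside A. *)
Require Import Defs.
From mathcomp Require Import all_boot.
From mathcomp Require Import zify.
From Stdlib Require Import ClassicalEpsilon.

Set Implicit Arguments.
Unset Strict Implicit.
Unset Printing Implicit Defensive.

(** * Strategies from invariants *)

(** The strategy picks, by [epsilon], a legal move that restores the invariant. Since [I] speaks of
    complete rounds, a play that stops after a move of WBreaker is covered by the [bs'] of the round
    before. *)
Lemma strategy_of_invariant (n : nat) (m0 : move n)
    (I : seq (move n) -> seq (move n) -> Prop) :
  I [::] [::] ->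
  (forall bs ms b, size bs = size ms -> I bs ms -> legal_move bs ms b ->
     exists m, legal_move ms (rcons bs b) m /\ I (rcons bs b) (rcons ms m)) ->
  exists sigma : strategy n, legal_strategy sigma /\
    forall bs ms, play sigma bs ms -> exists2 bs', size bs' = size ms & I bs' ms.
Proof.
move=> I0 Istep.
pose good bs ms m := legal_move ms bs m /\ I bs (rcons ms m).
pose sigma bs ms := epsilon (inhabits m0) (good bs ms).
have inv bs ms : play sigma bs ms ->
    (size bs = size ms /\ I bs ms) \/
    (size bs = (size ms).+1 /\ exists m, good bs ms m).
  elim=> {bs ms} [|bs ms b _ [[sz Ibs]|[sz _]] sz' leg|bs ms _ [[sz _]|[_ ex]] sz'].
  - by left.
  - by right; rewrite size_rcons sz; split=> //; apply: Istep.
  - by lia.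
  - by lia.
  - by left; rewrite size_rcons; split=> //; case: (epsilon_spec (inhabits m0) _ ex).
have last_inv bs ms : play sigma bs ms -> exists2 bs', size bs' = size ms & I bs' ms.
  elim=> {bs ms} [|bs ms b _ // |bs ms pl [bs' sz' _] sz]; first by exists [::].
  have [[]|[_ ex]] := inv _ _ pl; first by lia.
  exists bs; first by rewrite size_rcons.
  by case: (epsilon_spec (inhabits m0) _ ex).
exists sigma; split=> // bs ms pl sz.
have [[]|[_ ex]] := inv _ _ pl; first by lia.
by case: (epsilon_spec (inhabits m0) _ ex).
Qed.

(** * Spanning trees of connected graphs *)

Lemma adj_sym (n : nat) (E : {set {set 'I_n}}) : symmetric (adj E).
Proof. by move=> u v; rewrite /adj setUC. Qed.

Lemma set2_eq (T : finType) (x y p q : T) :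
  [set x; y] = [set p; q] -> (x == p) || (x == q).
Proof. by move=> e; rewrite -in_set2 -e set21. Qed.

(** A minimal connected set of edges is a tree: an edge of a cycle could be deleted, the rest of the
    cycle being a detour. *)
Lemma connected_has_spanning_tree (n : nat) (E : {set {set 'I_n}}) :
  E \subset complete_edges n -> connected_graph E -> contains_spanning_tree E.
Proof.
move=> subE conE.
pose conb (F : {set {set 'I_n}}) := [forall u, forall v, connect (adj F) u v].
have conP F : reflect (connected_graph F) (conb F).
  by apply: (iffP forallP) => H u; [move/forallP: (H u) | apply/forallP].
have [T /minsetP[/conP conT minT] subT] := minset_exists (introT (conP E) conE).
exists T; split=> //; split=> //; first exact: subset_trans subE.
case=> -[|x [|y [|z s]]] [] // _ /andP[].
rewrite (cycle_path x) => pthT uq.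
have /andP[exy pth] : adj T x y && path (adj T) y (rcons (z :: s) x).
  by move: pthT; rewrite -cycle_path.
pose T' := T :\ [set x; y].
(* The path from [y] back to [x] avoids the edge xy: before its last step it misses [x], and the
   last step does not start at [y], as the cycle has a third vertex. *)
have {}pth : path (adj T') y (rcons (z :: s) x).
  move: pth; rewrite !rcons_path => /andP[pth exl].
  apply/andP; split.
    apply: (@sub_in_path _ (predC1 x)) pth => [u v ux vx uv|].
      rewrite /adj !inE; apply/andP; split=> //.
      apply/eqP=> /esym/set2_eq; move: ux vx; rewrite !inE.
      by rewrite !(eq_sym x) => /negbTE-> /negbTE->.
    by apply/allP=> u us; rewrite inE; apply: contraTneq uq => <-; rewrite cons_uniq us.
  rewrite /adj !inE; apply/andP; split=> //.
  apply/eqP=> e.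
  have ylast: y = last y (z :: s).
    have : y \in [set last y (z :: s); x] by rewrite e set22.
    rewrite in_set2 => /orP[/eqP //|/eqP yx].
    by move: uq; rewrite yx /= inE eqxx.
  by move: uq; rewrite ylast /= mem_last andbF.
have conxy : connect (adj T') x y.
  rewrite (sym_connect_sym (@adj_sym _ T')); apply/connectP.
  by exists (rcons (z :: s) x); rewrite ?last_rcons.
have conT' : conb T'.
  apply/conP=> u v; apply: connect_sub (conT u v) => {}u {}v uv.
  have [e|ne] := eqVneq [set u; v] [set x; y]; last first.
    by apply: connect1; rewrite /adj !inE ne.
  have := set2_eq e; have := e; rewrite setUC => /set2_eq.
  have yx : connect (adj T') y x by rewrite (sym_connect_sym (@adj_sym _ T')).
  by case/orP=> /eqP ->; case/orP=> /eqP ->; rewrite ?connect0.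
have /setP/(_ [set x; y]) := minT _ conT' (subD1set _ _).
by rewrite !inE eqxx /=; move: exy; rewrite /adj => ->.
Qed.

(** * Walks and the vertices they visit *)

Lemma claimed_rcons (n : nat) (s : seq (move n)) (m : move n) :
  claimed (rcons s m) = move_edge m |: claimed s.
Proof. by apply/setP=> e; rewrite !inE map_rcons mem_rcons inE. Qed.

(* The dummy move (x, x) places the player at x before the first real move. *)
Definition walk (n : nat) (x : 'I_n) (s : seq (move n)) : bool :=
  path (fun m m' => (m'.1 == m.2) && (m'.1 != m'.2)) (x, x) s.

Definition position (n : nat) (x : 'I_n) (s : seq (move n)) : 'I_n :=
  (last (x, x) s).2.

Definition visited (n : nat) (x : 'I_n) (s : seq (move n)) : {set 'I_n} :=
  [set y in x :: [seq m.2 | m <- s]].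

Lemma walk_rcons (n : nat) (x : 'I_n) (s : seq (move n)) (m : move n) :
  walk x (rcons s m) = [&& walk x s, m.1 == position x s & m.1 != m.2].
Proof. by rewrite /walk rcons_path. Qed.

Lemma position_rcons (n : nat) (x : 'I_n) (s : seq (move n)) (m : move n) :
  position x (rcons s m) = m.2.
Proof. by rewrite /position last_rcons. Qed.

Lemma visited_rcons (n : nat) (x : 'I_n) (s : seq (move n)) (m : move n) :
  visited x (rcons s m) = m.2 |: visited x s.
Proof. by apply/setP=> y; rewrite !inE map_rcons mem_rcons inE orbCA. Qed.

Lemma position_visited (n : nat) (x : 'I_n) (s : seq (move n)) :
  position x s \in visited x s.
Proof.
case/lastP: s => [|s m]; first by rewrite inE /= inE.
by rewrite position_rcons visited_rcons setU11.
Qed.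

Lemma walk_complete (n : nat) (x : 'I_n) (s : seq (move n)) :
  walk x s -> claimed s \subset complete_edges n.
Proof.
elim/last_ind: s => [|s m IH]; first by move=> _; apply/subsetP=> e; rewrite inE.
rewrite walk_rcons claimed_rcons subUset sub1set inE cards2 => /and3P[/IH -> _ ->].
by [].
Qed.

Lemma walk_connect (n : nat) (x : 'I_n) (s : seq (move n)) :
  walk x s -> {in visited x s, forall y, connect (adj (claimed s)) x y}.
Proof.
elim/last_ind: s => [_ y|s m IH].
  by rewrite !inE => /eqP ->; apply: connect0.
rewrite walk_rcons => /and3P[/IH {}IH /eqP pos _] y.
have mono z : z \in visited x s -> connect (adj (claimed (rcons s m))) x z.
  move=> /IH; apply: connect_sub => u v uv; apply: connect1.
  by rewrite /adj claimed_rcons inE [_ \in claimed s]uv orbT.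
rewrite visited_rcons => /setU1P[->|]; last exact: mono.
apply: connect_trans (mono m.1 _) _; first by rewrite pos position_visited.
by apply: connect1; rewrite /adj claimed_rcons setU11.
Qed.

Lemma walk_spanning (n : nat) (x : 'I_n) (s : seq (move n)) :
  walk x s -> visited x s = setT -> contains_spanning_tree (claimed s).
Proof.
move=> wk vis; apply: connected_has_spanning_tree (walk_complete wk) _ => u v.
have con y : connect (adj (claimed s)) x y by apply: walk_connect; rewrite ?vis.
by apply: connect_trans (con v); rewrite (sym_connect_sym (@adj_sym _ _)).
Qed.

(** * Neighbours of a set along a walk *)

Definition boundary (n : nat) (B : {set {set 'I_n}}) (A : {set 'I_n}) : {set 'I_n} :=
  [set x | (x \notin A) && [exists a in A, [set x; a] \in B]].

(* Of three consecutive steps of a walk at most two reach a new neighbour of A,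
   which the potential added to [2 * size s] keeps track of. *)
Lemma walk_boundary (n : nat) (x : 'I_n) (s : seq (move n)) (A : {set 'I_n}) :
  walk x s ->
  3 * #|boundary (claimed s) A| <=
    2 * size s + (if position x s \in A then 1
                  else if position x s \in boundary (claimed s) A then 2 else 0).
Proof.
elim/last_ind: s => [_|s m IH].
  suff ->: boundary (claimed [::]) A = set0 by rewrite cards0.
  apply/setP=> y; rewrite !inE; apply/negbTE; rewrite negb_and; apply/orP; right.
  by apply/existsP=> -[a]; rewrite inE andbF.
rewrite walk_rcons => /and3P[/IH {IH} + /eqP pos neq].
rewrite position_rcons size_rcons claimed_rcons -pos /move_edge.
set p := m.1; set q := m.2; set N := boundary _ A; set N' := boundary _ A.
have subN : N \subset N'.
  apply/subsetP=> y; rewrite !inE => /andP[-> /existsP[a /andP[aA e]]].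
  by apply/existsP; exists a; rewrite aA in_setU1 e orbT.
have newN y : y \in N' -> [|| y \in N, (y == p) && (q \in A) && (p \notin A)
                                     | (y == q) && (p \in A) && (q \notin A)].
  rewrite !inE => /andP[yA /existsP[a /andP[aA]]]; rewrite inE => /orP[|e]; last first.
    by apply/orP; left; rewrite yA; apply/existsP; exists a; rewrite aA.
  rewrite inE => /eqP e; apply/orP; right.
  have := set2_eq e; have := e; rewrite setUC => /set2_eq.
  case/orP=> /eqP ea; case/orP=> /eqP ey; move: aA yA; rewrite ea ey => ->.
  - by [].
  - by move=> ->; rewrite eqxx orbT.
  - by move=> ->; rewrite eqxx.
  - by [].
have qN : p \in A -> q \notin A -> q \in N'.
  move=> pA qA; rewrite !inE qA; apply/existsP; exists p.
  by rewrite pA !inE setUC eqxx.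
have card_add y : N' \subset y |: N -> #|N'| <= (y \notin N) + #|N|.
  by move=> /subset_leq_card; rewrite cardsU1.
have card_eq : N' \subset N -> #|N'| <= #|N| by apply: subset_leq_card.
(* Leaving [A], or entering it from outside [N], raises the potential by 1, which with the 2 of the
   step pays for one new neighbour. All other steps add none and lower the potential by at most
   2. *)
have [pA|pA] := boolP (p \in A); have [qA|qA] := boolP (q \in A).
- have /card_eq : N' \subset N.
    by apply/subsetP=> y /newN; rewrite pA qA !andbF !orbF.
  by lia.
- rewrite qN //.
  have /card_add : N' \subset q |: N.
    by apply/subsetP=> y /newN; rewrite pA !andbF orFb !inE => /orP[->|/andP[/andP[->]]]; rewrite ?orbT.
  by lia.
- have /card_add : N' \subset p |: N.
    by apply/subsetP=> y /newN; rewrite qA !andbF orbF !inE => /orP[->|/andP[/andP[->]]]; rewrite ?orbT.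
  by case: (p \in N) => /=; lia.
- have /card_eq : N' \subset N.
    by apply/subsetP=> y /newN; rewrite (negbTE pA) (negbTE qA) !andbF !orbF.
  by case: (p \in N); case: (q \in N'); lia.
Qed.

(** The potential is at most 2, so fewer than [n] vertices lie in [A] or its boundary. *)
Lemma walk_free_vertex (n : nat) (x : 'I_n) (s : seq (move n)) (A : {set 'I_n}) :
  walk x s -> 3 * #|A| + 2 * size s + 2 < 3 * n ->
  exists2 y, y \notin A & {in A, forall a, [set y; a] \notin claimed s}.
Proof.
move=> wk lt; have bd := walk_boundary A wk.
have : 0 < #|~: (A :|: boundary (claimed s) A)|.
  have := cardsC (A :|: boundary (claimed s) A); rewrite card_ord.
  have [] := leq_card_setU A (boundary (claimed s) A).
  by move: bd; case: ifP => _; [|case: ifP => _]; lia.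
case/card_gt0P=> y; rewrite !inE negb_or => /andP[yA].
rewrite yA /= => /existsPn noe; exists y => // a aA.
by move: (noe a); rewrite aA.
Qed.

(** * WMaker's reply in each phase *)

(* The situation after WMaker's moves: B is WBreaker's graph, p and v are the positions
   of WBreaker and WMaker, U is the set of vertices WMaker has not visited, and w
   counts her moves that did not reach a new vertex. *)
Inductive phase (n : nat) (B : {set {set 'I_n}}) (p v : 'I_n) :
    {set 'I_n} -> nat -> Prop :=
| phase_done w : phase B p v set0 w
| phase_open (U : {set 'I_n}) of {in U &, forall x y, [set x; y] \notin B}
    & #|[set x in U | [set v; x] \in B]| <= (p == v) : phase B p v U 0
| phase_two a c of a != c & p = c & [set v; a] \notin B & [set v; c] \notin B
    & [set a; c] \notin B : phase B p v [set a; c] 1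
| phase_last a w of w <= 1 & p = a : phase B p v [set a] w
| phase_reach a w of w <= 2 & p != a & p != v & [set v; a] \notin B :
    phase B p v [set a] w.

Lemma phase_waste (n : nat) (B : {set {set 'I_n}}) (p v : 'I_n) (U : {set 'I_n})
    (w : nat) :
  phase B p v U w -> U != set0 -> w <= 2.
Proof. by case=> // [w'|a w' /leq_trans->]; rewrite ?eqxx. Qed.

Lemma setU1_notin (T : finType) (B : {set {set T}}) (e f : {set T}) (z : T) :
  e \notin B -> z \in f -> z \notin e -> e \notin f |: B.
Proof.
by move=> eB zf ze; rewrite in_setU1 negb_or eB andbT; apply: contraNneq ze => ->.
Qed.

(** Here [B] already contains WBreaker's move to [q]. If va is taken, the wasted move to [y] leaves
    ya open to attack only when [q] is [a]; the bound on [w] keeps a second wasted move in reserve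
    for that case. *)
Lemma phase_single_step (n : nat) (B : {set {set 'I_n}}) (q v a : 'I_n) (w : nat) :
  v != a -> w + (q == a) <= 1 ->
  (exists2 y, y \notin [set v; a; q] & {in [set v; a; q], forall x, [set y; x] \notin B}) ->
  exists u, [/\ u != v, [set v; u] \notin B &
                phase B q u ([set a] :\ u) (w + (u \notin [set a]))].
Proof.
move=> va wq [y]; rewrite !inE !negb_or => /andP[/andP[yv ya] yq] free.
have [vaB|vaB] := boolP ([set v; a] \in B); last first.
  by exists a; rewrite eq_sym setDv; split=> //; apply: phase_done.
exists y; split=> //; first by rewrite setUC free // !inE eqxx.
have -> : [set a] :\ y = [set a] by apply/setDidPl; rewrite disjoints1 inE eq_sym.
rewrite inE ya; have [qa|qa] := eqVneq q a.
  by apply: phase_last => //; move: wq; rewrite qa eqxx; lia.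
apply: phase_reach; rewrite ?qa 1?eq_sym //; first by move: wq; rewrite (negbTE qa); lia.
by rewrite free // !inE eqxx orbT.
Qed.

(** The hypothesis [free] supplies the targets of wasted moves; three vertices to avoid are enough,
    namely [v], [a] and [q]. *)
Lemma phase_step (n : nat) (B : {set {set 'I_n}}) (p q v : 'I_n) (U : {set 'I_n})
    (w : nat) :
  phase B p v U w -> v \notin U -> U != set0 -> p != q ->
  (forall A : {set 'I_n}, #|A| <= 3 ->
     exists2 y, y \notin A & {in A, forall a, [set y; a] \notin [set p; q] |: B}) ->
  exists u, [/\ u != v, [set v; u] \notin [set p; q] |: B &
                phase ([set p; q] |: B) q u (U :\ u) (w + (u \notin U))].
Proof.
move=> ph vU U0 pq free; set B' := _ |: B.
have free3 x y z : exists2 t, t \notin [set x; y; z] &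
    {in [set x; y; z], forall a, [set t; a] \notin B'}.
  apply: free; apply: leq_trans (leq_card_setU _ _).1 _.
  by rewrite cards2 cards1; case: (x != y).
case: ph vU U0 => {U w} [w|U indep deg|a c ac pc vaB vcB acB|a w w1 pa|a w w2 pa pv va] vU U0.
- by rewrite eqxx in U0.
- have [/cards1P[a Ua]|U1] := boolP (#|U| == 1).
    rewrite Ua in vU *; apply: phase_single_step; rewrite ?add0n ?leq_b1 //.
    by rewrite inE in vU.
  have U2 : 1 < #|U| by move: U0 U1; rewrite -card_gt0; lia.
  have notv x : x \in U -> x != v by apply: contraTneq => ->.
  (* If WBreaker walks inside [U], then [p] differs from [v], so [deg] excludes an old edge from [v]
     to [q]. *)
  have [/andP[pU qU]|npq] := boolP ((p \in U) && (q \in U)).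
    have vqB : [set v; q] \notin B.
      apply/negP=> vqB; move: deg; rewrite (negbTE (notv p pU)) leqn0 cards_eq0.
      by move/eqP/setP/(_ q); rewrite !inE qU vqB.
    exists q; split; first exact: notv.
      by apply: (setU1_notin (z := p)); rewrite ?set21 // !inE negb_or notv.
    rewrite qU addn0; apply: phase_open.
      move=> x y /setD1P[xq xU] /setD1P[yq yU].
      by apply: (setU1_notin (z := q)); rewrite ?set22 ?indep // !inE negb_or !(eq_sym q) xq.
    rewrite eqxx; apply: (@leq_trans #|[set p]|); last by rewrite cards1.
    apply/subset_leq_card/subsetP=> x.
    rewrite !inE => /andP[/andP[xq xU]]; rewrite (negbTE (indep _ _ qU xU)) orbF setUC.
    by move/eqP/set2_eq; rewrite (negbTE xq) orbF.
  have indep' : {in U &, forall x y, [set x; y] \notin B'}.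
    move=> x y xU yU; have xyU z : z \notin U -> z \notin [set x; y].
      by apply: contraNN; rewrite !inE => /orP[] /eqP ->.
    by move: npq; rewrite negb_and => /orP[] /xyU; apply: setU1_notin; rewrite ?indep ?set21 ?set22.
  have [/existsP[u /andP[uU vu]]|/existsPn nou] := boolP [exists u in U, [set v; u] \notin B'].
    exists u; split=> //; first exact: notv.
    rewrite uU addn0; apply: phase_open.
      by move=> x y /setD1P[_ xU] /setD1P[_ yU]; apply: indep'.
    rewrite (_ : [set _ in _ | _] = set0) ?cards0 //.
    apply/setP=> x; rewrite in_set0 in_set; apply/negbTE/negP=> /andP[/setD1P[_ xU]].
    by rewrite (negbTE (indep' _ _ uU xU)).
  (* Now every vertex of [U] is blocked. If [p != v], only the new edge can block, and only the
     vertex [p]. If [p = v], the exceptional edge and the new one block two vertices, so [U] is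
     [[set a; q]] and a move is wasted. *)
  pose D := [set x in U | [set v; x] \in B].
  have Uv x : x \in U -> [set v; x] = [set p; q] \/ [set v; x] \in B.
    by move=> xU; have := nou x; rewrite xU negbK in_setU1 => /orP[/eqP|]; [left|right].
  have [pv|pv] := eqVneq p v; last first.
    suff /subset_leq_card : U \subset [set p] by rewrite cards1 leqNgt U2.
    apply/subsetP=> x xU; case: (Uv x xU) => [e|vx].
      by have /esym/set2_eq := e; rewrite (negbTE pv) inE eq_sym.
    move: deg; rewrite (negbTE pv) leqn0 cards_eq0 => /eqP/setP/(_ x).
    by rewrite !inE xU vx.
  rewrite pv eqxx in deg *.
  have degP := card_le1_eqP deg.
  have Uq x : x \in U -> x != q -> x \in [set x in U | [set v; x] \in B].
    move=> xU xq; case: (Uv x xU) => [|vx]; last by rewrite inE xU.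
    by rewrite setUC => /set2_eq; rewrite pv (negbTE (notv x xU)) (negbTE xq).
  have [a aU aq] : exists2 a, a \in U & a != q.
    have : 0 < #|U :\ q| by move: U2; rewrite (cardsD1 q U); case: (q \in U); case: #|_|.
    by case/card_gt0P=> a /setD1P[aq aU]; exists a.
  have qU : q \in U.
    apply: contraTT U2 => qU; rewrite -leqNgt; apply: leq_trans deg.
    by apply/subset_leq_card/subsetP=> x xU; apply: Uq => //; apply: contraNneq qU => <-.
  have Uaq : U = [set a; q].
    apply/setP=> x; rewrite !inE; apply/idP/orP => [xU|[] /eqP -> //].
    by have [->|xq] := eqVneq x q; [right|left; apply/eqP/degP; apply: Uq].
  have [y] := free3 v a q; rewrite !inE !negb_or => /andP[/andP[yv ya] yq] yfree.
  have yU : y \notin U by rewrite Uaq !inE negb_or ya.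
  exists y; split=> //; first by rewrite setUC yfree // !inE eqxx.
  have -> : U :\ y = [set a; q] by rewrite -Uaq; apply/setDidPl; rewrite disjoint_sym disjoints1.
  by rewrite yU; apply: phase_two; rewrite ?yfree ?indep' ?inE ?eqxx ?orbT.
(* If WBreaker claims the edge between the last two vertices, WMaker takes the one he left.
   Otherwise she takes [a], and he stands at neither end of the edge to the other one. *)
- rewrite -{}pc in ac vU U0 vcB acB pq *; move: vU; rewrite !inE negb_or => /andP[va vp].
  have qp : q != p by rewrite eq_sym.
  have [qa|qa] := eqVneq q a.
    exists p; split; first by rewrite eq_sym.
      by apply: (setU1_notin (z := q)); rewrite ?set22 // !inE negb_or qp qa eq_sym va.
    have -> : [set a; p] :\ p = [set a].
      by apply/setP=> x; rewrite !inE; case: (eqVneq x p) => [->|]; rewrite ?orbF // eq_sym (negbTE ac).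
    by rewrite set22; apply: phase_last.
  exists a; split; first by rewrite eq_sym.
    by apply: (setU1_notin (z := p)); rewrite ?set21 // !inE negb_or !(eq_sym p) vp ac.
  have -> : [set a; p] :\ a = [set p].
    by apply/setP=> x; rewrite !inE; case: (eqVneq x a) => [->|]; rewrite //= (negbTE ac).
  rewrite set21; apply: phase_reach => //.
  by apply: (setU1_notin (z := q)); rewrite ?set22 // !inE negb_or qa.
(* WBreaker has to leave [a], so at most one more move is wasted. *)
- rewrite -{}pa in vU U0 *.
  apply: phase_single_step => //; first by rewrite inE in vU.
  by rewrite eq_sym (negbTE pq) addn0.
(* WBreaker began his move at neither end of va, so this edge is still free. *)
- rewrite inE in vU; exists a; split; first by rewrite eq_sym.
    by apply: (setU1_notin (z := p)); rewrite ?set21 // !inE negb_or pv.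
  by rewrite setDv; apply: phase_done.
Qed.

(** * The invariant along the play *)

(** Without waste the visited vertices outnumber the moves by one, for the starting vertex; [w]
    corrects this. That WMaker's last edge is not WBreaker's makes it possible to walk back along
    it. *)
Definition in_phase (n : nat) (bs ms : seq (move n)) : Prop :=
  exists (x y : 'I_n) (w : nat),
    [/\ walk x bs, walk y ms,
        exists s m, ms = rcons s m /\ move_edge m \notin claimed bs,
        (size ms).+1 + #|~: visited y ms| = n + w &
        phase (claimed bs) (position x bs) (position y ms) (~: visited y ms) w].

Lemma from_position_rcons (n : nat) (x : 'I_n) (s : seq (move n)) (m0 m : move n) :
  from_position (rcons s m0) m = (m.1 == position x (rcons s m0)).
Proof. by case: s. Qed.

(** WMaker's first edge ends at WBreaker's position, so that his only edge is the exception allowed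
    by [phase_open]. *)
Lemma in_phase_start (n : nat) (b : move n) :
  2 < n -> b.1 != b.2 ->
  exists m, legal_move [::] [:: b] m /\ in_phase [:: b] [:: m].
Proof.
case: b => p q /= n2 pq.
have [y] : exists y, y \notin [set p; q].
  have : 0 < #|~: [set p; q]| by have := cardsC [set p; q]; rewrite card_ord cards2 pq; lia.
  by case/card_gt0P=> y; rewrite inE; exists y.
rewrite !inE negb_or => /andP[yp yq].
have claimedE : claimed [:: (p, q)] = [set p; q] |: set0.
  by apply/setP=> e; rewrite !inE orbF.
have yqF : [set y; q] \notin claimed [:: (p, q)].
  by rewrite claimedE; apply: (setU1_notin (z := p)); rewrite ?in_set0 // ?in_set2 ?eqxx // negb_or (eq_sym p y) yp.
have visE : visited y [:: (y, q)] = [set y; q] by apply/setP=> z; rewrite !inE.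
exists (y, q); split; first by rewrite /legal_move /= inE cards2 yq.
exists p, y, 0; split; rewrite ?visE.
- by rewrite /walk /= eqxx pq.
- by rewrite /walk /= eqxx yq.
- by exists [::], (y, q).
- by rewrite addn0 -[RHS]card_ord -(cardsC [set y; q]) cards2 yq.
- apply: phase_open.
    move=> z t; rewrite !in_setC !in_set2 !negb_or => /andP[_ zq] /andP[_ tq].
    rewrite claimedE; apply: (setU1_notin (z := q)); rewrite ?set22 ?in_set0 //.
    by rewrite in_set2 negb_or !(eq_sym q) zq.
  rewrite /position /= eqxx; apply: (@leq_trans #|[set p]|); last by rewrite cards1.
  apply/subset_leq_card/subsetP=> z; rewrite in_set in_setC in_set2 negb_or.
  case/andP=> /andP[_ zq]; rewrite claimedE in_setU1 in_set0 orbF setUC.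
  by move/eqP/set2_eq; rewrite (negbTE zq) orbF in_set1.
Qed.

Lemma in_phase_step (n : nat) (bs ms : seq (move n)) (b : move n) :
  13 < n -> size bs = size ms -> in_phase bs ms -> legal_move bs ms b ->
  exists m, legal_move ms (rcons bs b) m /\ in_phase (rcons bs b) (rcons ms m).
Proof.
move=> n13 sz [x [y [w [wkb wkm [s [m [msE mB]]] cnt ph]]]] /and3P[posb].
rewrite inE cards2 => edgeb freshb.
have b12 : b.1 != b.2 by case: (b.1 == b.2) edgeb.
have posbx : b.1 = position x bs.
  case/lastP: bs sz posb {wkb mB ph freshb} => [|s' m']; rewrite msE ?size_rcons //.
  by rewrite (from_position_rcons x) => _ /eqP.
have posm : position y ms = m.2 by rewrite msE position_rcons.
have wkb' : walk x (rcons bs b) by rewrite walk_rcons wkb posbx eqxx -posbx.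
have m12 : m.1 != m.2 by move: wkm; rewrite msE walk_rcons => /and3P[].
suff [u [uv free ph']] : exists u, [/\ u != position y ms,
    [set position y ms; u] \notin claimed (rcons bs b) &
    phase (claimed (rcons bs b)) b.2 u (~: visited y ms :\ u) (w + (u \in visited y ms))].
  exists (position y ms, u); split.
    rewrite /legal_move {1}msE (from_position_rcons y) -msE eqxx /=.
    by rewrite free inE cards2 (eq_sym _ u) uv.
  exists x, y, (w + (u \in visited y ms)).
  have UE : ~: visited y (rcons ms (position y ms, u)) = ~: visited y ms :\ u.
    by rewrite visited_rcons setCU setIC -setDE.
  rewrite UE !position_rcons (walk_rcons y) wkm eqxx /= (eq_sym _ u) uv size_rcons; split=> //.
    by exists ms, (position y ms, u).
  move: cnt; rewrite (cardsD1 u) in_setC; set k := #|_|.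
  by case: (u \in _) => /=; lia.
have [U0|U0] := eqVneq (~: visited y ms) set0.
  (* When all is visited, WMaker walks back along her last edge, which [b] cannot have claimed. *)
  exists m.1; rewrite posm; split=> //; last by rewrite U0 set0D; apply: phase_done.
  rewrite claimed_rcons in_setU1 negb_or setUC mB andbT.
  apply: contraNneq freshb => e; rewrite msE claimed_rcons in_setU1 /move_edge e.
  by rewrite eqxx.
have [||A A3|u [uv free ph']] := phase_step ph _ U0 _ (q := b.2).
- by rewrite inE negbK position_visited.
- by rewrite -posbx.
- rewrite -posbx -[[set _; _]]/(move_edge b) -claimed_rcons.
  (* As [w <= 2] and some vertex is unvisited, [size bs <= n]. With three vertices to avoid and
     [n + 1] steps the condition becomes [2 * n + 13 < 3 * n], whence [13 < n]. *)
  apply: walk_free_vertex wkb' _; rewrite size_rcons.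
  have := phase_waste ph U0; move: U0; rewrite -card_gt0; lia.
- exists u; move: free ph'; rewrite -posbx -[[set b.1; _]]/(move_edge b) -claimed_rcons.
  by rewrite in_setC negbK.
Qed.

(** After [n.+1] moves, an unvisited vertex would force [w >= 3] in the count of moves, against
    [phase_waste]. *)
Lemma in_phase_end (n : nat) (bs ms : seq (move n)) :
  in_phase bs ms -> size ms = n.+1 -> contains_spanning_tree (claimed ms).
Proof.
case=> x [y [w [_ wkm _ cnt ph]]] sz; apply: walk_spanning wkm _.
apply/eqP; rewrite -(inj_eq (@setC_inj _)) setCT; apply: contraT => U0.
by have := phase_waste ph U0; move: U0; rewrite -card_gt0; lia.
Qed.

Theorem theorem1 :
  exists n0 : nat, forall n : nat, n0 <= n ->
    exists sigma : strategy n,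
      legal_strategy sigma /\ wins_connectivity_within sigma n.+1.
Proof.
exists 14 => n n14.
have m0 : move n by case: n n14 => // n _; exact: (ord0, ord0).
(* The empty play is a separate case because [in_phase] refers to a last move of WMaker. *)
pose I (bs ms : seq (move n)) := bs = [::] /\ ms = [::] \/ in_phase bs ms.
have [||sigma [leg inv]] := strategy_of_invariant m0 (I := I); first by left.
  move=> bs ms b sz [[-> ->]|ph] legb.
    have b12 : b.1 != b.2.
      by case/and3P: legb => _; rewrite inE cards2; case: (b.1 == b.2).
    have [||m [legm ph]] := @in_phase_start n b; rewrite ?(leq_trans _ n14) //.
    by exists m; split; [|right].
  have [m [legm ph']] := in_phase_step n14 sz ph legb.
  by exists m; split; [|right].
exists sigma; split=> // bs ms /inv[bs' _ [[_ ->]|ph]] // sz.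
by exists n.+1; rewrite // take_oversize ?sz //; apply: in_phase_end ph sz.
Qed.
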